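(* Any streaming certification scheme for $\mathrm{Diameter}_{\leq 2}$ whose verifier uses $m$ bits of memory and whose certificates have $c$ bits satisfies $c+m=\Omega(n^2)$ on $n$-node graphs.
   Context: $\mathrm{Diameter}_{\leq 2}$ is the decision problem (with fixed threshold $2$) taking as input a graph $G$ and asking whether the diameter of $G$ is at most $2$. The $n$-node input graph on $[n]$ is given as a stream of edges in an arbitrary, possibly adversarial, order. A streaming certification scheme for a decision problem $P$ consists of a prover (a computationally unlimited function producing a certificate in $\{0,1\}^*$ depending only on the input graph, not on the edge order) and a verifier (a deterministic streaming algorithm with read-only access to the certificate that processes the stream and outputs accept or reject). Completeness: if $G$ satisfies $P$, some certificate makes the verifier accept for every edge order. Soundness: if $G$ does not satisfy $P$, the verifier rejects for every certificate and every edge order. $c$ is the certificate length and $m$ the verifier's memory excluding the certificate, as worst-case functions of $n$. *)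

(* Defs.v *)
From mathcomp Require Import all_boot.

Set Implicit Arguments.
Unset Strict Implicit.
Unset Printing Implicit Defensive.

(* A simple graph on the vertex set 'I_n is its set of edges, each edge being
   a two-element set of vertices. *)
Definition simple_graph (n : nat) (E : {set {set 'I_n}}) : bool :=
  [forall e in E, #|e| == 2].

Definition graph (n : nat) : Type := {E : {set {set 'I_n}} | simple_graph E}.

Definition edges (n : nat) (G : graph n) : {set {set 'I_n}} := val G.

(* Irreflexive, since [set u; u] is a singleton and hence never an edge. *)
Definition adj (n : nat) (G : graph n) : rel 'I_n :=
  [rel u v | [set u; v] \in edges G].

Definition walk (n : nat) (G : graph n) (k : nat) (u v : 'I_n) : bool :=
  [exists p : k.-tuple 'I_n, path (adj G) u p && (last u p == v)].

(* The least length k < n of a walk from u to v; shortest paths have fewer than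
   n edges. The default value n, when v is not reachable from u, is never used
   by [diameter]. *)
Definition dist (n : nat) (G : graph n) (u v : 'I_n) : nat :=
  find (fun k => walk G k u v) (iota 0 n).

(* [None] stands for infinity: the diameter of a disconnected graph. *)
Definition diameter (n : nat) (G : graph n) : option nat :=
  if [forall u, forall v, connect (adj G) u v]
  then Some (\max_(u < n) \max_(v < n) dist G u v)
  else None.

Definition diameter_le (d n : nat) (G : graph n) : bool :=
  if diameter G is Some k then k <= d else false.

(* The edge streams of G: every edge occurs exactly once, in any order. *)
Definition is_stream (n : nat) (G : graph n) (s : seq {set 'I_n}) : bool :=
  perm_eq s (enum (edges G)).

(* A deterministic streaming algorithm on n-node graphs with m bits of memory.
   Each operation takes the certificate as its first argument: the certificate
   can be read at any time, and it does not count as memory. *)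
Record verifier (n m : nat) : Type := Verifier {
  init : seq bool -> m.-tuple bool;
  step : seq bool -> m.-tuple bool -> {set 'I_n} -> m.-tuple bool;
  accept : seq bool -> m.-tuple bool -> bool
}.

Definition accepts (n m : nat) (V : verifier n m) (w : seq bool)
    (s : seq {set 'I_n}) : bool :=
  accept V w (foldl (step V w) (init V w) s).

(* Streaming certification schemes for P with, on n-node graphs, certificates
   of at most [c n] bits and a verifier using [m n] bits of memory. Soundness
   is against arbitrary certificates, of any length. *)
Record streaming_certification (P : forall n : nat, graph n -> bool)
    (c m : nat -> nat) : Type := StreamingCertification {
  prover : forall n : nat, graph n -> seq bool;
  verif : forall n : nat, verifier n (m n);
  certificate_size : forall (n : nat) (G : graph n),
    P n G -> size (prover G) <= c n;
  completeness : forall (n : nat) (G : graph n), P n G ->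
    forall s, is_stream G s -> accepts (verif n) (prover G) s;
  soundness : forall (n : nat) (G : graph n), ~~ P n G ->
    forall w s, is_stream G s -> ~~ accepts (verif n) w s
}.

(* Main.v *)
Require Import Defs.
From mathcomp Require Import all_boot zify.

(* A fooling set of size 2 ^ (k * k), with k about n / 4. For a set x of pairs
   (i, j), Alice holds the edges a_i -- b'_j with (i, j) in x and Bob the edges
   a'_i -- b_j with (i, j) not in x, besides fixed edges among which a_i -- a'_i
   and b_j -- b'_j. With two hubs z, z' every other pair of vertices is within
   distance 2, so that combining Alice's x with Bob's y gives diameter at most 2
   iff y is a subset of x. When x and y share both the certificate and the memory
   state after Alice's edges, both mixed graphs are accepted, hence x = y; thus
   2 ^ (k * k) is at most the number of pairs (certificate, memory state). *)

Set Implicit Arguments.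
Unset Strict Implicit.
Unset Printing Implicit Defensive.

(** * Fooling sets against streaming certification schemes *)

(** Certificates may be shorter than [c n]; there are fewer than [2 ^ (c n).+1] of them, whence the
    successor in the exponent. *)
Lemma fooling_set_bound (P : forall n, graph n -> bool) (c m : nat -> nat)
    (S : streaming_certification P c m) (n : nat) (I : finType)
    (A B : I -> {set {set 'I_n}}) (G : I -> I -> graph n) :
    (forall i j, edges (G i j) = A i :|: B j) ->
    (forall i j, [disjoint A i & B j]) ->
    (forall i, P n (G i i)) ->
    (forall i j, P n (G i j) -> P n (G j i) -> i = j) ->
  #|I| <= 2 ^ (c n + m n).+1.
Proof.
move=> GE AB0 Pii Pinj.
pose w i := prover S (G i i).
pose state i := foldl (step (verif S n) (w i)) (init (verif S n) (w i)) (enum (A i)).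
have stream i j : is_stream (G i j) (enum (A i) ++ enum (B j)).
  apply: uniq_perm; rewrite ?enum_uniq //.
    rewrite cat_uniq !enum_uniq andbT /=; apply/hasPn => e.
    rewrite !mem_enum => eB; apply/negP => eA.
    by have := disjointFr (AB0 i j) eA; rewrite eB.
  by move=> e; rewrite mem_cat !mem_enum GE inE.
(* With certificate [w j], reading [B j] from the common state gives the same verdict on [G i j] as
   on [G j j], namely acceptance; soundness then forces [P]. *)
have swap i j : w i = w j -> state i = state j -> P n (G i j).
  move=> wij sij; apply/negPn/negP => nP.
  have := soundness S nP (w j) (stream i j).
  have := completeness S (Pii j) (stream j j).
  by rewrite /accepts !foldl_cat -/(w j) -/(state j) -sij /state wij => ->.
(* Padding on the left by [0...01] makes all certificates equally long. *)
pose pad i := nseq (c n - size (w i)) false ++ true :: w i.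
have padP i : size (pad i) == (c n).+1.
  have := certificate_size S (Pii i); rewrite size_cat size_nseq /= -/(w i).
  by move=> ?; apply/eqP; lia.
have padI i j : pad i = pad j -> w i = w j.
  rewrite /pad; elim: (c n - size (w i)) (c n - size (w j)) => [|a IH] [|b] //=.
    by case.
  by case=> /IH.
pose code i : (c n).+1.-tuple bool * (m n).-tuple bool := (Tuple (padP i), state i).
have codeI : injective code.
  move=> i j [/padI wij sij]; apply: Pinj; exact: swap.
have := leq_card code codeI.
by rewrite card_prod !card_tuple card_bool -expnD addSn.
Qed.

(** * Diameter at most 2 in terms of common neighbours *)

Definition within2 (n : nat) (G : graph n) (u v : 'I_n) : bool :=
  [|| u == v, adj G u v | [exists w, adj G u w && adj G w v]].

Lemma within2P (n : nat) (G : graph n) (u v : 'I_n) :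
  reflect (exists2 k, k <= 2 & walk G k u v) (within2 G u v).
Proof.
apply: (iffP or3P) => [[/eqP <-|uv|/existsP[w /andP[uw wv]]]|].
- by exists 0 => //; apply/existsP; exists [tuple]; rewrite /= eqxx.
- by exists 1 => //; apply/existsP; exists [tuple v]; rewrite /= uv eqxx.
- by exists 2 => //; apply/existsP; exists [tuple w; v]; rewrite /= uw wv eqxx.
case=> [[|[|[|k]]]] // _ /existsP[[s sz]] /=.
- by move: s sz => [|? ?] //= _ uv; constructor 1.
- by move: s sz => [|a [|? ?]] //= _; rewrite andbT => /andP[? /eqP<-]; constructor 2.
- move: s sz => [|a [|b [|? ?]]] //= _; rewrite andbT => /andP[? /eqP<-].
  by constructor 3; apply/existsP; exists a.
Qed.

Lemma diameter_le2P (n : nat) (G : graph n) : 2 < n ->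
  reflect (forall u v, within2 G u v) (diameter_le 2 G).
Proof.
move=> n2; rewrite /diameter_le /diameter.
apply: (iffP idP) => [|G2].
  case: ifP => // _ /bigmax_leqP D u v.
  have /bigmax_leqP/(_ v isT) duv := D u isT.
  apply/within2P; exists (dist G u v) => //.
  (* As [2 < n], a distance of at most 2 is not the default value [n], so it is the length of an
     actual walk. *)
  have lt_n : dist G u v < n by apply: leq_ltn_trans n2.
  have : has (fun k => walk G k u v) (iota 0 n) by rewrite has_find size_iota.
  by move/(nth_find 0); rewrite nth_iota.
rewrite ifT.
  apply/bigmax_leqP => u _; apply/bigmax_leqP => v _.
  have /within2P[k k2 kw] := G2 u v.
  apply: leq_trans k2; rewrite leqNgt; apply/negP => lt_k.
  have := before_find 0 lt_k; rewrite nth_iota ?kw //.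
  by apply: leq_trans lt_k _; rewrite -[leqRHS](size_iota 0) find_size.
apply/forallP => u; apply/forallP => v; have /within2P[k _ /existsP[p]] := G2 u v.
by case/andP=> pp /eqP<-; apply/connectP; exists p.
Qed.

(** * The gadget graphs *)

(** The relation may list each edge in one orientation only; it lives on [nat] so that vertices are
    compared by linear arithmetic. *)
Definition edge_set (n : nat) (r : rel nat) : {set {set 'I_n}} :=
  [set e | [exists u : 'I_n, exists v : 'I_n, r u v && (e == [set u; v])]].

Lemma mem_edge_set (n : nat) (r : rel nat) (u v : 'I_n) :
  ([set u; v] \in edge_set n r) = r u v || r v u.
Proof.
rewrite inE; apply/existsP/orP => [[a /existsP[b /andP[rab /eqP E]]]|[ruv|rvu]]; last first.
- by exists v; apply/existsP; exists u; rewrite rvu setUC eqxx.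
- by exists u; apply/existsP; exists v; rewrite ruv eqxx.
have: u \in [set a; b] by rewrite -E set21.
have: v \in [set a; b] by rewrite -E set22.
have: a \in [set u; v] by rewrite E set21.
have: b \in [set u; v] by rewrite E set22.
by rewrite !inE; do 4![case/orP=> /eqP ?]; subst; auto.
Qed.

Lemma simple_edge_set (n : nat) (r : rel nat) :
  irreflexive r -> simple_graph (edge_set n r).
Proof.
move=> irr; apply/'forall_implyP => e; rewrite inE.
case/existsP=> u /existsP[v /andP[ruv /eqP->]]; rewrite cards2.
by case: (eqVneq u v) ruv => // ->; rewrite irr.
Qed.

(** The bipartite graph with biadjacency matrix [x] between the blocks of [k] vertices starting at
    [p] and at [q]. *)
Definition block_edges (k p q : nat) (x : {set 'I_k * 'I_k}) : rel nat :=
  fun u v => [exists i : 'I_k, exists j : 'I_k,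
    [&& (i, j) \in x, u == p + i & v == q + j]].

Lemma block_edgesP (k p q : nat) (x : {set 'I_k * 'I_k}) (u v : nat) :
  reflect (exists i j : 'I_k, [/\ (i, j) \in x, u = p + i & v = q + j])
          (block_edges p q x u v).
Proof.
apply: (iffP existsP) => [[i /existsP[j /and3P[xij /eqP-> /eqP->]]]|].
  by exists i, j.
by case=> i [j [xij -> ->]]; exists i; apply/existsP; exists j; rewrite xij !eqxx.
Qed.

(* The vertices are a_i = i, a'_i = k + i, b_j = 2k + j, b'_j = 3k + j for
   i, j < k, the two hubs z = 4k and z' = 4k + 1, and padding vertices. *)
Definition hub_edges (k : nat) : rel nat := fun u v =>
  [|| ((u < k) || (2 * k <= u < 3 * k)) && (v == u + k),
      [|| u < 2 * k, 3 * k <= u < 4 * k | 4 * k + 2 <= u] && (v == 4 * k)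
    | ((k <= u < 4 * k) || (4 * k + 2 <= u)) && (v == 4 * k + 1)].

Definition alice (k : nat) (x : {set 'I_k * 'I_k}) : rel nat :=
  block_edges 0 (3 * k) x.

Definition bob (k : nat) (y : {set 'I_k * 'I_k}) : rel nat :=
  fun u v => hub_edges k u v || block_edges k (2 * k) (~: y) u v.

Definition gadget_rel (k : nat) (x y : {set 'I_k * 'I_k}) : rel nat :=
  fun u v => alice x u v || bob y u v.

Lemma gadget_rel_irr (k : nat) (x y : {set 'I_k * 'I_k}) :
  irreflexive (gadget_rel x y).
Proof.
move=> u; apply/negP; case/or3P.
- by case/block_edgesP=> i [j [_]]; have := ltn_ord i; lia.
- by rewrite /hub_edges; lia.
- by case/block_edgesP=> i [j [_]]; have := ltn_ord i; lia.
Qed.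

Definition gadget (n k : nat) (x y : {set 'I_k * 'I_k}) : graph n :=
  exist _ (edge_set n (gadget_rel x y)) (simple_edge_set n (gadget_rel_irr x y)).

Lemma adj_gadget (n k : nat) (x y : {set 'I_k * 'I_k}) (u v : 'I_n) :
  adj (gadget n x y) u v = gadget_rel x y u v || gadget_rel x y v u.
Proof. exact: mem_edge_set. Qed.

Lemma edges_gadget (n k : nat) (x y : {set 'I_k * 'I_k}) :
  edges (gadget n x y) = edge_set n (alice x) :|: edge_set n (bob y).
Proof.
apply/setP => e; rewrite !inE; apply/idP/orP => [|[]] /existsP[u /existsP[v]].
- by case/andP=> /orP[] r e_uv; [left | right];
    apply/existsP; exists u; apply/existsP; exists v; rewrite r.
- case/andP=> r e_uv; apply/existsP; exists u; apply/existsP; exists v.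
  by rewrite /gadget_rel r.
- case/andP=> r e_uv; apply/existsP; exists u; apply/existsP; exists v.
  by rewrite /gadget_rel r orbT.
Qed.

(** Only Alice joins the block of the a_i to that of the b'_j. *)
Lemma alice_bob_disjoint (n k : nat) (x y : {set 'I_k * 'I_k}) :
  [disjoint edge_set n (alice x) & edge_set n (bob y)].
Proof.
apply/pred0P => e /=; apply/negP => /andP[]; rewrite inE.
case/existsP=> u /existsP[v /andP[/block_edgesP[i [j [_ ui vj]]] /eqP->]].
rewrite mem_edge_set; have := ltn_ord i; have := ltn_ord j.
by move=> ? ?; case/orP=> /orP[|/block_edgesP[i' [j' [_]]]];
  rewrite /hub_edges; have := ltn_ord; lia.
Qed.

(** * The diameter of the gadget and inclusion of sets *)

(** Among the vertices other than hubs, z is adjacent to all but the b_j and z' to all but the a_i,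
    so only pairs a_i, b_j share no hub. These meet at b'_j if [(i, j)] is in [x], and at a'_i
    otherwise. *)
Lemma gadget_diameter (n k : nat) (x : {set 'I_k * 'I_k}) :
  0 < k -> 4 * k + 2 <= n -> diameter_le 2 (gadget n x x).
Proof.
move=> k0 kn; apply/diameter_le2P; first lia.
pose E u v := gadget_rel x x u v || gadget_rel x x v u.
pose near2 u v := [\/ u = v, E u v | exists w, [/\ w < n, E u w & E w v]].
suff near2T u v : u < n -> v < n -> near2 u v.
  move=> u v; apply/or3P; case: (near2T u v (ltn_ord u) (ltn_ord v)).
  - by move/val_inj/eqP; constructor 1.
  - by rewrite /E; constructor 2; rewrite adj_gadget.
  - case=> w [wn uw wv]; constructor 3; apply/existsP; exists (Ordinal wn).
    by rewrite !adj_gadget; apply/andP.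
have EC a b : E a b = E b a by rewrite /E orbC.
have near2C a b : near2 a b -> near2 b a.
  case=> [->|ab|[w [wn aw wb]]]; first by constructor 1.
    by constructor 2; rewrite EC.
  by constructor 3; exists w; rewrite EC [E w a]EC.
have hub a b : hub_edges k a b || hub_edges k b a -> E a b.
  by rewrite /E /gadget_rel /bob; case/orP=> ->; rewrite ?orbT.
have via w a b : w < n -> hub_edges k a w || hub_edges k w a ->
    hub_edges k b w || hub_edges k w b -> near2 a b.
  by move=> wn aw bw; constructor 3; exists w; split=> //; [|rewrite EC]; exact: hub.
have ab a b : a < k -> 2 * k <= b < 3 * k -> near2 a b.
  move=> ak bk; have bk' : b - 2 * k < k by lia.
  constructor 3; have [inx|ninx] := boolP ((Ordinal ak, Ordinal bk') \in x).
    exists (b + k); split; [lia| |apply: hub; rewrite /hub_edges; lia].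
    rewrite /E /gadget_rel; apply/orP; left; apply/orP; left; apply/block_edgesP.
    by exists (Ordinal ak), (Ordinal bk'); split=> //=; lia.
  exists (a + k); split; [lia|apply: hub; rewrite /hub_edges; lia|].
  rewrite /E /gadget_rel /bob; apply/orP; left; apply/or3P; constructor 3.
  apply/block_edgesP; exists (Ordinal ak), (Ordinal bk'); rewrite inE.
  by split=> //=; lia.
have hubs a b : a < n -> b < n -> (a == 4 * k) || (a == 4 * k + 1) -> near2 a b.
  move=> an bn az; have [->|ne] := eqVneq a b; first by constructor 1.
  have [h|] := boolP (hub_edges k a b || hub_edges k b a).
    by constructor 2; exact: hub.
  move=> nh; have [bh|bh] := boolP ((b == 4 * k) || (b == 4 * k + 1)).
    (* Vertex [k] is a'_0, adjacent to both hubs. *)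
    by apply: (via k); rewrite /hub_edges; lia.
  (* The other non-neighbours are the b_j for z and the a_i for z'; in both cases [b + k] is the
     primed partner of [b], adjacent to either hub. *)
  have bk : (a == 4 * k) && (2 * k <= b < 3 * k) || (a == 4 * k + 1) && (b < k).
    by case/orP: az nh => /eqP->; rewrite /hub_edges; lia.
  by case/orP: bk => /andP[/eqP-> bk]; apply: (via (b + k)); rewrite /hub_edges; lia.
move=> un vn.
have [uz|uz] := boolP ((u == 4 * k) || (u == 4 * k + 1)); first exact: hubs.
have [vz|vz] := boolP ((v == 4 * k) || (v == 4 * k + 1)).
  by apply: near2C; exact: hubs.
have [uv|nuv] := boolP ((u < k) && (2 * k <= v < 3 * k)).
  by case/andP: uv; exact: ab.
have [vu|nvu] := boolP ((v < k) && (2 * k <= u < 3 * k)).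
  by apply: near2C; case/andP: vu; exact: ab.
have [aa|naa] := boolP ((u < k) || (v < k)).
  by apply: (via (4 * k)); rewrite /hub_edges; lia.
by apply: (via (4 * k + 1)); rewrite /hub_edges; lia.
Qed.

(** The neighbours of a_i are a'_i, z and some b'; those of b_j are b'_j, z' and some a'. A common
    neighbour is thus b'_j, so that [(i, j)] is in [x], or a'_i, so that [(i, j)] is not in [y]. *)
Lemma gadget_sub (n k : nat) (x y : {set 'I_k * 'I_k}) :
  0 < k -> 4 * k + 2 <= n -> diameter_le 2 (gadget n x y) -> y \subset x.
Proof.
move=> k0 kn /diameter_le2P-/(_ ltac:(lia)) G2.
apply/subsetP => -[i j] yij; have ik := ltn_ord i; have jk := ltn_ord j.
have un : i < n by lia.
have vn : 2 * k + j < n by lia.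
have relE a b : gadget_rel x y a b ->
  [\/ exists i j : 'I_k, [/\ (i, j) \in x, a = i & b = 3 * k + j], hub_edges k a b
    | exists i j : 'I_k, [/\ (i, j) \notin y, a = k + i & b = 2 * k + j]].
  case/or3P=> [/block_edgesP ?|?|/block_edgesP[a' [b' []]]].
  - by constructor 1.
  - by constructor 2.
  - by rewrite inE => ? ? ?; constructor 3; exists a', b'.
have from_a w : gadget_rel x y i w || gadget_rel x y w i ->
    (exists2 j' : 'I_k, (i, j') \in x & w = 3 * k + j') \/ (w = i + k \/ w = 4 * k).
  case/orP=> /relE[[i' [j' [xij e1 e2]]]|h|[i' [j' [_ e1 e2]]]].
  - by left; exists j' => //; rewrite (val_inj e1).
  - by right; move: h; rewrite /hub_edges; lia.
  - by lia.
  - by lia.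
  - by move: h; rewrite /hub_edges; lia.
  - by lia.
have to_b w : gadget_rel x y w (2 * k + j) || gadget_rel x y (2 * k + j) w ->
    (exists2 i' : 'I_k, (i', j) \notin y & w = k + i') \/
    (w = 3 * k + j \/ w = 4 * k + 1).
  case/orP=> /relE[[i' [j' [xij e1 e2]]]|h|[i' [j' [nyij e1 e2]]]].
  - by have := ltn_ord i'; lia.
  - by move: h; rewrite /hub_edges; lia.
  - left; exists i' => //; suff -> : j = j' by [].
    by apply: val_inj => /=; lia.
  - by have := ltn_ord i'; lia.
  - by right; move: h; rewrite /hub_edges; lia.
  - by have := ltn_ord i'; lia.
case/or3P: (G2 (Ordinal un) (Ordinal vn)) => [/eqP[]||/existsP[w /andP[]]].
- by lia.
- by rewrite adj_gadget /= => /to_b[[i' _]|]; lia.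
rewrite !adj_gadget /= => /from_a F /to_b T.
case: F => [[j' xij' wj]|wi].
  case: T => [[i' _ wi']|wj']; first by have := ltn_ord i'; lia.
  suff -> : j = j' by [].
  by apply: val_inj => /=; have := ltn_ord j'; lia.
case: T => [[i' nyi' wi']|]; last by lia.
suff ii : i = i' by rewrite -ii yij in nyi'.
by apply: val_inj => /=; have := ltn_ord i'; lia.
Qed.

(** * The quadratic lower bound *)

Lemma diameter_scheme_bound (c m : nat -> nat)
    (S : streaming_certification (diameter_le 2) c m) (n k : nat) :
  0 < k -> 4 * k + 2 <= n -> k * k <= (c n + m n).+1.
Proof.
move=> k0 kn.
have := @fooling_set_bound _ c m S n {set 'I_k * 'I_k}
  (fun x => edge_set n (alice x)) (fun y => edge_set n (bob y)) (@gadget n k).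
rewrite -cardsT -powersetT card_powerset cardsT card_prod card_ord leq_exp2l //.
apply=> [x y|x y|x|x y xy yx].
- exact: edges_gadget.
- exact: alice_bob_disjoint.
- exact: gadget_diameter.
- by apply/eqP; rewrite eqEsubset !(@gadget_sub n).
Qed.

Corollary diameter_scheme_quadratic (c m : nat -> nat)
    (S : streaming_certification (diameter_le 2) c m) (n : nat) :
  10 <= n -> n ^ 2 <= 98 * (c n + m n).
Proof.
(* The largest [k] for which the gadget fits into [n] vertices; [10 <= n] gives [2 <= k], hence
   [n <= 4 * k + 5 <= 7 * k]. *)
move=> n10; pose k := (n - 2) %/ 4.
have k2 : 2 <= k by rewrite /k; lia.
have kn : 4 * k + 2 <= n by rewrite /k; lia.
have := diameter_scheme_bound S (ltnW k2) kn.
have n7k : n <= 7 * k by move: kn k2; rewrite /k; lia.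
have : n ^ 2 <= (7 * k) ^ 2 by rewrite leq_sqr.
(* This makes [c n + m n] positive, so the successor costs at most a factor 2, and 98 is 2 times
   49. *)
have : 2 * 2 <= k * k by exact: leq_mul.
by rewrite -!mulnn; lia.
Qed.

(* Imported only here, because mathcomp.classical shadows the notations of
   finite sets. *)
From mathcomp Require Import all_order all_algebra.
From mathcomp Require Import all_classical all_reals topology normedtype landau.
Local Open Scope classical_set_scope.
Local Open Scope ring_scope.
Import GRing.Theory Num.Theory.

Theorem theorem17 (R : realType) (c m : nat -> nat)
    (S : streaming_certification (diameter_le 2) c m) :
  (fun n : nat => (c n + m n)%:R : R^o) \is 'Omega_\oo (fun n : nat => n%:R ^+ 2 : R^o).
Proof.
apply/asboolP; exists 98%:R^-1; first by rewrite invr_gt0 ltr0n.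
exists 10%N => // n /= n10.
rewrite !ger0_norm ?exprn_ge0 ?ler0n //.
rewrite ler_pdivrMl ?ltr0n //.
rewrite -natrX -natrM ler_nat.
exact: diameter_scheme_quadratic.
Qed.
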